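(* There is an absolute constant $\delta \geq 10^{-9}$ such that for all sufficiently large integers $c$, there exist finite simple graphs $G,H$ with $\chi(G)\geq (1+\delta)c$, $\chi(H)\geq (1+\delta)c$, and $\chi(G\times H)\leq c$.
   Context: For finite graphs $G$ and $H$, the tensor product $G\times H$ is the graph on vertex set $V(G)\times V(H)$ in which $(g_1,h_1)$ and $(g_2,h_2)$ are adjacent if and only if $g_1\sim g_2$ in $G$ and $h_1\sim h_2$ in $H$. $\chi$ denotes the chromatic number. *)

(* Defs.v *)
From mathcomp Require Import all_boot all_order all_algebra.
Set Implicit Arguments. Unset Strict Implicit. Unset Printing Implicit Defensive.

Definition simple_graph (T : finType) (e : rel T) : Prop :=
  symmetric e /\ irreflexive e.

Definition proper_colouring (T : finType) (e : rel T) (k : nat) (f : T -> 'I_k) : Prop :=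
  forall x y, e x y -> f x != f y.

Definition colourable (T : finType) (e : rel T) (k : nat) : Prop :=
  exists f : T -> 'I_k, proper_colouring e f.

(* chromatic number: the least k such that a proper k-colouring exists
   (always exists: k = #|T| works for loopless graphs). *)
Definition chi_of (T : finType) (e : rel T) (k : nat) : Prop :=
  colourable e k /\ forall j, colourable e j -> k <= j.

Definition tensor_rel (T U : finType) (e : rel T) (f : rel U) : rel (T * U) :=
  fun p q => e p.1 q.1 && f p.2 q.2.

(* Main.v *)
Require Import Defs.
From mathcomp Require Import all_boot all_order all_algebra.
From mathcomp Require Import zify ring lra.
Set Implicit Arguments. Unset Strict Implicit. Unset Printing Implicit Defensive.

(* Fix a graph F without closed walks of length 5 whose independent sets have
   density at most 1/200, let q be about c/100, let G be the strong product of
   F with K_q, and let H be the exponential graph of all maps G -> [c], where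
   f ~ g iff f x <> g y for every edge xy of G. Then (x, f) |-> f x is a proper
   c-colouring of G x H, and chi(G) >= 200 q >= 2 c. For F one can take the
   binary cube with nearly antipodal points joined: an independent set is far
   from its antipodal image, hence small by isoperimetry.

   Suppose H is coloured with fewer than 1.01 c colours. On the maps that are
   constant on the fibres of G -> F, a colour class is a family of maps
   F -> [c] any two of which collide on an edge or a vertex. If it contains
   many f with f v = b, then all its members take the value b on the closed
   neighbourhood N[v]. A count yields one v at which almost every b in [c] owns
   such a colour col b, so that at most about 0.02 c colours remain. Let mu_t
   use 2q colours within distance 2 of v and t elsewhere, let psi_t be t on
   N[v] and another colour t' elsewhere, and let cst_t be constant. Each of the
   three families is a clique of H (for t in a suitable range of size about
   c/2), so for most t the maps mu_t, psi_t, cst_t all receive owned colours.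
   The colours of psi_t and cst_t can only be col t. As mu_t ~ cst_b for b <> t
   outside the 2q colours, mu_t is also coloured col t, although
   mu_t ~ psi_t. *)

(** * The antipodal graph on the binary cube *)

Fixpoint cube (d : nat) : finType :=
  match d with 0 => unit | d'.+1 => (bool * cube d')%type end.

Fixpoint hamming (d : nat) : cube d -> cube d -> nat :=
  match d with
  | 0 => fun _ _ => 0
  | d'.+1 => fun x y => (x.1 != y.1) + hamming x.2 y.2
  end.

Fixpoint antipode (d : nat) : cube d -> cube d :=
  match d with
  | 0 => fun x => x
  | d'.+1 => fun x => (~~ x.1, antipode x.2)
  end.

Lemma card_cube d : #|cube d| = 2 ^ d.
Proof. by elim: d => [|d IHd]; rewrite ?card_unit // card_prod card_bool IHd expnS. Qed.

Lemma antipodeK d : involutive (@antipode d).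
Proof. by elim: d => [|d IHd] //= -[a x] /=; rewrite negbK IHd. Qed.

Lemma hamming_xx d (x : cube d) : hamming x x = 0.
Proof. by elim: d x => [|d IHd] //= x; rewrite eqxx IHd. Qed.

Lemma hamming_sym d (x y : cube d) : hamming x y = hamming y x.
Proof. by elim: d x y => [|d IHd] //= x y; rewrite IHd eq_sym. Qed.

Lemma hamming_triangle d (x y z : cube d) :
  hamming x z <= hamming x y + hamming y z.
Proof.
elim: d x y z => [|d IHd] //= -[a x] [b y] [c z] /=.
by have := IHd x y z; case: a; case: b; case: c => /=; lia.
Qed.

Lemma hamming_antipode d (x y : cube d) :
  hamming x (antipode y) + hamming x y = d.
Proof.
elim: d x y => [|d IHd] //= -[a x] [b y] /=.
by have := IHd x y; case: a; case: b => /=; lia.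
Qed.

Lemma hamming_antipode2 d (x y : cube d) :
  hamming (antipode x) (antipode y) = hamming x y.
Proof. by elim: d x y => [|d IHd] //= -[[] x] [[] y] /=; rewrite IHd. Qed.

Lemma card_slices d (A : {set cube d.+1}) :
  #|A| = #|[set x : cube d | (true, x) \in A]|
         + #|[set x : cube d | (false, x) \in A]|.
Proof.
rewrite -!sum1dep_card -sum1_card big_mkcond /=.
transitivity (\sum_(p : bool * cube d) if (p.1, p.2) \in A then 1 else 0).
  by apply: eq_bigr => -[].
rewrite -(pair_bigA _ (fun a x => if (a, x) \in A then 1 else 0)).
by rewrite big_bool -!big_mkcond.
Qed.

(* Splitting along one coordinate gives four pairs of slices; the two crossed
   pairs are only at distance s - 1, but the product of their sizes is the
   product of the sizes of the two straight pairs. *)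
Lemma cube_isoperimetry d s (A B : {set cube d}) :
    (forall x y, x \in A -> y \in B -> s <= hamming x y) ->
  #|A| * #|B| * 2 ^ s * 2 ^ d <= 9 ^ d.
Proof.
elim: d s A B => [|d IHd] s A B dAB.
  have [->|[x xA]] := set_0Vmem A; first by rewrite cards0.
  have [->|[y yB]] := set_0Vmem B; first by rewrite cards0 muln0.
  have := dAB _ _ xA yB; rewrite leqn0 => /eqP ->.
  have := max_card A; have := max_card B; rewrite card_unit => B1 A1.
  by rewrite !muln1; apply: (leq_mul A1 B1).
rewrite !card_slices.
pose sl (C : {set cube d.+1}) b := [set x : cube d | (b, x) \in C].
have slP b : #|sl A b| * #|sl B b| * 2 ^ s * 2 ^ d <= 9 ^ d.
  apply: IHd => x y; rewrite !inE => xA yB.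
  by have := dAB _ _ xA yB; rewrite /= eqxx.
have slN b : #|sl A b| * #|sl B (~~ b)| * 2 ^ s * 2 ^ d <= 2 * 9 ^ d.
  have h : #|sl A b| * #|sl B (~~ b)| * 2 ^ s.-1 * 2 ^ d <= 9 ^ d.
    apply: IHd => x y; rewrite !inE => xA yB.
    by have := dAB _ _ xA yB; case: (b) => /=; lia.
  have h2 : 2 ^ s <= 2 * 2 ^ s.-1 by rewrite -expnS leq_exp2l //; lia.
  apply: leq_trans (_ : 2 * (#|sl A b| * #|sl B (~~ b)| * 2 ^ s.-1 * 2 ^ d) <= _).
    by rewrite mulnA leq_mul2r; apply/orP; right; rewrite mulnCA leq_mul2l h2 orbT.
  by rewrite leq_mul2l.
move: (slP true) (slP false) (slN true) (slN false) => /=.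
rewrite -/(sl A true) -/(sl A false) -/(sl B true) -/(sl B false) !expnS.
move: (2 ^ s) (2 ^ d) (9 ^ d) => z1 z2 N.
move: #|sl A true| #|sl A false| #|sl B true| #|sl B false| => a a' b b'.
rewrite -!(mulnA _ z1); set z := z1 * z2 => h1 h2 h3 h4.
have hp : (a * b' * z) * (a' * b * z) <= N * N.
  apply: leq_trans (leq_mul h1 h2); apply: eq_leq; ring.
have -> : (a + a') * (b + b') * (z1 * (2 * z2))
   = 2 * (a * b * z + a' * b' * z) + 2 * (a * b' * z + a' * b * z).
  by rewrite /z; ring.
move: (a * b * z) (a' * b' * z) (a * b' * z) (a' * b * z) h1 h2 h3 h4 hp.
move=> x y u w h1 h2 h3 h4 hp.
(* From [u, w <= 2 * N] and [u * w <= N * N] the sum [u + w] is at most 2N + N/2; with [x, y <= N]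
   the total is at most 4N + 5N = 9N. *)
suff : 2 * (u + w) <= 5 * N by lia.
have [uN|Nu] := leqP (2 * u) N; first by lia.
nia.
Qed.

Definition antipodal_rel d s : rel (cube d) := fun x y => d < hamming x y + s.

Lemma antipodal_relE d s (x y : cube d) :
  antipodal_rel s x y = (hamming x (antipode y) < s).
Proof. by rewrite /antipodal_rel; have := hamming_antipode x y; lia. Qed.

Definition no_closed_5walk (V : finType) (e : rel V) :=
  forall x0 x1 x2 x3 x4, e x0 x1 -> e x1 x2 -> e x2 x3 -> e x3 x4 -> ~~ e x4 x0.

(** Replacing every other vertex by its antipode turns five edges into five steps, each shorter than
    s, from [x0] to its antipode at distance 5s. *)
Lemma antipodal_no_closed_5walk s : no_closed_5walk (@antipodal_rel (5 * s) s).
Proof.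
move=> x0 x1 x2 x3 x4; rewrite !antipodal_relE -leqNgt => h1 h2 h3 h4.
have := hamming_antipode x0 x0.
rewrite hamming_xx addn0.
have := hamming_triangle x0 (antipode x1) (antipode x0).
have := hamming_triangle (antipode x1) x2 (antipode x0).
have := hamming_triangle x2 (antipode x3) (antipode x0).
have := hamming_triangle (antipode x3) x4 (antipode x0).
rewrite -(hamming_antipode2 x1 (antipode x2)) antipodeK in h2.
rewrite -(hamming_antipode2 x3 (antipode x4)) antipodeK in h4.
by lia.
Qed.

Lemma antipodal_independent d s (A : {set cube d}) :
    (forall x y, x \in A -> y \in A -> ~~ antipodal_rel s x y) ->
  #|A| * #|A| * 2 ^ s * 2 ^ d <= 9 ^ d.
Proof.
move=> indA.
rewrite -{2}(card_imset A (inv_inj (@antipodeK d))).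
apply: cube_isoperimetry => x _ xA /imsetP[y yA ->].
by have := indA x y xA yA; rewrite antipodal_relE -leqNgt.
Qed.

(** The ratio 2 * 8^5 / 9^5 exceeds 11/10, and Bernoulli gives (11/10)^s >= 1 + s/10, so s = 10K
    suffices. *)
Lemma expn_gap K : exists s, K * 9 ^ (5 * s) <= 2 ^ s * 8 ^ (5 * s).
Proof.
have bernoulli s : (s + 10) * 10 ^ s <= 10 * 11 ^ s.
  elim: s => // s; rewrite !expnS; move: (10 ^ s) (11 ^ s) => t e IHs.
  have : (s.+1 + 10) * (10 * t) <= 11 * ((s + 10) * t).
    by rewrite !mulnA leq_mul2r; apply/orP; right; lia.
  by lia.
have [s Ks] : exists s, s = 10 * K by eexists.
exists s; have hs := bernoulli s.
have base : 11 * 9 ^ 5 <= 10 * (2 * 8 ^ 5) by vm_compute.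
rewrite !expnM -expnMn.
move: (9 ^ 5) (2 * 8 ^ 5) base => x y base.
have pw : (11 * x) ^ s <= (10 * y) ^ s by case: (s) => // s'; rewrite leq_exp2r.
rewrite !expnMn in pw.
rewrite -(@leq_pmul2l (10 * 10 ^ s)) ?muln_gt0 ?expn_gt0 //.
apply: leq_trans (_ : 10 * (11 ^ s * x ^ s) <= _); last by rewrite -mulnA leq_mul2l.
rewrite mulnA [10 * (_ * _)]mulnA leq_mul2r; apply/orP; right.
by apply: leq_trans hs; rewrite Ks; nia.
Qed.

Definition independent (V : finType) (e : rel V) (A : {set V}) :=
  forall x y, x \in A -> y \in A -> ~~ e x y.

Lemma sparse_no_closed_5walk K : exists (V : finType) (e : rel V),
  [/\ 0 < #|V|, symmetric e, no_closed_5walk e &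
      forall A, independent e A -> K * #|A| <= #|V| ].
Proof.
(* With d = 5s, an independent A has |A|^2 <= 9^d / (2^s 2^d), so K |A| <= 2^d follows from K^2 9^d
   <= 2^s 8^d. *)
have [s hs] := expn_gap (K ^ 2).
exists (cube (5 * s)), (@antipodal_rel (5 * s) s); split.
- by rewrite card_cube expn_gt0.
- by move=> x y; rewrite /antipodal_rel hamming_sym.
- exact: antipodal_no_closed_5walk.
move=> A indA; have := antipodal_independent indA.
have e8 : 8 ^ (5 * s) = (2 ^ (5 * s)) ^ 3 by rewrite -[8]/(2 ^ 3) -!expnM mulnC.
rewrite card_cube -(leq_sqr (K * _)); rewrite e8 in hs.
have z0 : 0 < 2 ^ s by rewrite expn_gt0.
have p0 : 0 < 2 ^ (5 * s) by rewrite expn_gt0.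
move: (2 ^ s) (2 ^ (5 * s)) (9 ^ (5 * s)) #|A| z0 p0 hs => z p N a z0 p0 hs ha.
rewrite -(@leq_pmul2l (z * p)) ?muln_gt0 ?z0 //.
apply: leq_trans (_ : K ^ 2 * (a * a * z * p) <= _).
  by apply: eq_leq; ring.
apply: leq_trans (_ : K ^ 2 * N <= _); first by rewrite leq_mul2l ha orbT.
by apply: leq_trans hs _; apply: eq_leq; ring.
Qed.

(** * Colourings of maps by few colours *)

Lemma leq_card_bigcup (I T : finType) (P : pred I) (F : I -> {set T}) :
  #|\bigcup_(i | P i) F i| <= \sum_(i | P i) #|F i|.
Proof.
elim/big_rec2: _ => [|i m A _ IH]; first by rewrite cards0.
by apply: leq_trans (leq_card_setU _ _).1 _; rewrite leq_add2l.
Qed.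

Lemma card_two_values (V : finType) (c : nat) (v y : V) (a b : 'I_c) :
  v != y ->
  #|[set f : {ffun V -> 'I_c} | (f v == a) && (f y == b)]| * c ^ 2 = c ^ #|V|.
Proof.
move=> vy; pose F x : pred 'I_c := if x == v then pred1 a else
  if x == y then pred1 b else predT.
have -> : #|[set f : {ffun V -> 'I_c} | (f v == a) && (f y == b)]| = #|family F|.
  apply: eq_card => f; rewrite inE; apply/andP/familyP => [[/eqP fv /eqP fy] x|h].
    by rewrite /F; case: eqP => [->|_]; [|case: eqP => [->|_]]; rewrite ?inE ?fv ?fy.
  have := h v; have := h y; rewrite /F !eqxx eq_sym (negbTE vy) !inE => -> ->.
  by [].
rewrite card_family foldrE big_image -[in RHS]prod_nat_const.
rewrite (bigD1 v) //= (bigD1 y) /=; last by rewrite eq_sym.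
rewrite [in RHS](bigD1 v) //= [in RHS](bigD1 y) /=; last by rewrite eq_sym.
rewrite /F !eqxx eq_sym (negbTE vy) !card1 !mul1n mulnC -mulnA; congr (_ * (_ * _)).
apply: eq_bigr => x /andP[/negbTE -> /negbTE ->]; by rewrite card_ord.
Qed.

Section Robust.
Variables (V : finType) (r : rel V) (c k : nat).
Variable Psi : {ffun V -> 'I_c} -> 'I_k.
Hypothesis r_sym : symmetric r.
Hypothesis collide : forall f g, Psi f = Psi g -> exists x y, r x y /\ f x = g y.

Let star (e : 'I_k) v b := [set f | (Psi f == e) && (f v == b)].

(* Cardinalities are compared after multiplication by c ^ 2, so that the bound
   #|V| ^ 2 * c ^ (#|V| - 2) needs no truncated subtraction. *)
Let large e v b := #|V| ^ 2 * c ^ #|V| < #|star e v b| * c ^ 2.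

(* Otherwise f collides with every g in the star at some y <> v, and for given
   x, y at most a 1 / c ^ 2 fraction of all maps has g v = b and g y = f x. *)
Lemma large_star_robust e v b f :
  large e v b -> Psi f = e -> exists2 w, r v w & f w = b.
Proof.
move=> lg fe; have [/existsP[w /andP[rvw /eqP fw]]|] :=
  boolP [exists w, r v w && (f w == b)]; first by exists w.
move=> /existsPn noW; exfalso; move: lg; apply/negP; rewrite -leqNgt.
pose two x y := [set g : {ffun V -> 'I_c} | (g v == b) && (g y == f x)].
have sub : star e v b \subset \bigcup_x \bigcup_(y | v != y) two x y.
  apply/subsetP => g; rewrite inE => /andP[/eqP ge /eqP gv].
  have [x [y [rxy fg]]] := @collide f g (etrans fe (esym ge)).
  apply/bigcupP; exists x => //; apply/bigcupP; exists y; last by rewrite inE gv fg !eqxx.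
  apply/eqP => vy; have := noW x; rewrite r_sym {1}vy rxy fg -vy gv eqxx //.
apply: leq_trans (_ : (\sum_(x : V) \sum_(y | v != y) #|two x y|) * c ^ 2 <= _).
  rewrite leq_mul2r (leq_trans (subset_leq_card sub)) ?orbT //.
  apply: leq_trans (leq_card_bigcup _ _) _.
  by apply: leq_sum => x _; exact: leq_card_bigcup.
rewrite big_distrl /= -mulnn -mulnA -sum_nat_const; apply: leq_sum => x _.
rewrite big_distrl /= -sum_nat_const [leqRHS](bigID (fun y => v != y)) /=.
by apply: leq_trans (leq_addr _ _); apply: leq_sum => y vy; rewrite card_two_values.
Qed.

(** If both values were large and distinct, every map in the star of b would also take the value b'
    at some w <> v; there are at most |V| c^(|V|-2) such maps. *)
Lemma large_star_uniq e v b b' : large e v b -> large e v b' -> b = b'.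
Proof.
move=> lg lg'; apply/eqP/negP => /negP bb'.
move: (lg); apply/negP; rewrite -leqNgt.
pose two y := [set g : {ffun V -> 'I_c} | (g v == b) && (g y == b')].
have sub : star e v b \subset \bigcup_(y | v != y) two y.
  apply/subsetP => g; rewrite inE => /andP[/eqP ge /eqP gv].
  have [w rvw gw] := large_star_robust lg' ge.
  apply/bigcupP; exists w; last by rewrite inE gv gw !eqxx.
  by apply: contraNneq bb' => vw; rewrite -gv -gw vw.
apply: leq_trans (_ : (\sum_(y | v != y) #|two y|) * c ^ 2 <= _).
  by rewrite leq_mul2r (leq_trans (subset_leq_card sub)) ?orbT // leq_card_bigcup.
apply: leq_trans (_ : #|V| * c ^ #|V| <= _); last first.
  by rewrite leq_mul2r -mulnn leq_pmull ?orbT //; apply/card_gt0P; exists v.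
rewrite big_distrl /= -sum_nat_const [leqRHS](bigID (fun y => v != y)) /=.
by apply: leq_trans (leq_addr _ _); apply: leq_sum => y vy; rewrite card_two_values.
Qed.

Let small v := [set b | [forall e, ~~ large e v b]].

(* If f has all its values in the small sets, then every g of the same kind and
   colour lies in one of the #|V| ^ 2 stars of values of f, none of them large. *)
Lemma card_small_family :
  (\prod_v #|small v|) * c ^ 2 <= k * #|V| ^ 4 * c ^ #|V|.
Proof.
have -> : \prod_v #|small v| = #|family (fun v => mem (small v))|.
  by rewrite card_family foldrE big_image.
pose A e := [set f in family (fun v => mem (small v)) | Psi f == e].
have -> : #|family (fun v => mem (small v))| = \sum_e #|A e|.
  rewrite -sum1_card (partition_big Psi predT) //=; apply: eq_bigr => e _.
  by rewrite sum1dep_card; apply: eq_card => f; rewrite !inE.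
rewrite big_distrl -!mulnA -[k in leqRHS]card_ord -sum_nat_const.
apply: leq_sum => e _.
have [->|[f]] := set_0Vmem (A e); first by rewrite cards0.
rewrite inE => /andP[/familyP fB /eqP fe].
have sub : A e \subset \bigcup_x \bigcup_(y | f x \in small y) star e y (f x).
  apply/subsetP => g; rewrite inE => /andP[/familyP gB /eqP ge].
  have [x [y [rxy fg]]] := @collide f g (etrans fe (esym ge)).
  apply/bigcupP; exists x => //; apply/bigcupP; exists y; first by rewrite fg; exact: gB.
  by rewrite inE ge fg !eqxx.
apply: leq_trans (_ : (\sum_(x : V) \sum_(y | f x \in small y) #|star e y (f x)|) * c ^ 2 <= _).
  rewrite leq_mul2r (leq_trans (subset_leq_card sub)) ?orbT //.
  apply: leq_trans (leq_card_bigcup _ _) _.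
  by apply: leq_sum => x _; exact: leq_card_bigcup.
rewrite big_distrl /= -sum_nat_const; apply: leq_sum => x _.
rewrite big_distrl /= -sum_nat_const [leqRHS](bigID (fun y => f x \in small y)) /=.
apply: leq_trans (leq_addr _ _); apply: leq_sum => y.
by rewrite inE => /forallP/(_ e); rewrite /large -leqNgt -mulnn -mulnA.
Qed.

(** If more than c/M values were small at every vertex, the product in [card_small_family] would
    exceed its bound for large c. So some v has few small values; S consists of the others, each
    with a colour of which it is the only large value. *)
Lemma robust_vertex M :
    0 < c -> k <= 2 * c -> 2 * M ^ #|V| * #|V| ^ 4 < c ->
  exists (v : V) (S : {set 'I_c}) (e : 'I_c -> 'I_k),
    [/\ M * (c - #|S|) <= c, {in S &, injective e} &
        forall b f, b \in S -> Psi f = e b -> exists2 w, r v w & f w = b].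
Proof.
move=> c0 kc cbig.
have [/existsP[v hv]|/existsPn hall] := boolP [exists v, M * #|small v| <= c].
  have k0 : 0 < k.
    by apply: leq_ltn_trans (leq0n _) (ltn_ord (Psi [ffun=> Ordinal c0])).
  pose e b := odflt (Ordinal k0) [pick e | large e v b].
  have eP b : b \in ~: small v -> large (e b) v b.
    rewrite !inE negb_forall => /existsP[x]; rewrite negbK => lx.
    by rewrite /e; case: pickP => [//|/(_ x)]; rewrite lx.
  exists v, (~: small v), e; split.
  - by rewrite -[X in X - _]card_ord -(cardsC (small v)) addnK.
  - move=> b b' bS b'S ebb'; apply: (@large_star_uniq (e b) v); first exact: eP.
    by rewrite ebb'; exact: eP.
  by move=> b f bS; apply: large_star_robust (eP b bS).
exfalso.
have h1 : c ^ #|V| <= M ^ #|V| * \prod_v #|small v|.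
  rewrite -!prod_nat_const -big_split /=; apply: leq_prod => v _.
  by rewrite ltnW // ltnNge; apply: hall.
have h2 := card_small_family.
have : c ^ #|V| * c ^ 2 <= (2 * M ^ #|V| * #|V| ^ 4) * c * c ^ #|V|.
  apply: leq_trans (_ : M ^ #|V| * (\prod_v #|small v|) * c ^ 2 <= _).
    by rewrite leq_mul2r h1 orbT.
  rewrite -mulnA; apply: leq_trans (_ : M ^ #|V| * (2 * c * #|V| ^ 4 * c ^ #|V|) <= _).
    by rewrite leq_mul2l (leq_trans h2) ?orbT // leq_mul2r leq_mul2r kc !orbT.
  by apply: eq_leq; ring.
apply/negP; rewrite -ltnNge [ltnRHS]mulnC ltn_pmul2r ?expn_gt0 ?c0 //.
by rewrite -mulnn ltn_pmul2r.
Qed.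

End Robust.

(** * The exponential graph of a blow-up *)

Definition blowup (V : finType) (e : rel V) (q : nat) : rel (V * 'I_q) :=
  fun x y => e x.1 y.1 || (x.1 == y.1) && (x.2 != y.2).

Definition exponential (T : finType) (e : rel T) (c : nat) : rel {ffun T -> 'I_c} :=
  fun f g => [forall x, forall y, e x y ==> (f x != g y)].

Lemma exponentialP (T : finType) (e : rel T) c (f g : {ffun T -> 'I_c}) :
  reflect (forall x y, e x y -> f x != g y) (exponential e f g).
Proof.
apply: (iffP forallP) => [h x y exy|h x]; first by have /forallP/(_ y)/implyP := h x; apply.
by apply/forallP => y; apply/implyP; apply: h.
Qed.

Lemma exponential_sym (T : finType) (e : rel T) c :
  symmetric e -> symmetric (@exponential T e c).
Proof.
move=> es f g; apply/exponentialP/exponentialP => h x y exy;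
by rewrite eq_sym; apply: h; rewrite es.
Qed.

Lemma tensor_exponential_colourable (T : finType) (e : rel T) c :
  colourable (tensor_rel e (@exponential T e c)) c.
Proof.
exists (fun p : T * {ffun T -> 'I_c} => p.2 p.1) => -[x f] [y g] /andP[/= exy /exponentialP]; exact.
Qed.

(** Fibres are cliques, so a colour class projects injectively onto an independent set and has at
    most |V|/K points; the k classes cover |V| q points. *)
Lemma colourable_blowup_ge (V : finType) (e : rel V) K q k :
    0 < #|V| -> (forall A, independent e A -> K * #|A| <= #|V|) ->
  colourable (@blowup V e q) k -> K * q <= k.
Proof.
move=> V0 sparse [f fP].
pose C i := [set x : V | [exists j, f (x, j) == i]].
have Cind i : independent e (C i).
  move=> x y; rewrite !inE => /existsP[j /eqP fx] /existsP[j' /eqP fy].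
  apply/negP => exy; have := fP (x, j) (y, j').
  by rewrite fx fy eqxx /blowup /= exy => /(_ isT).
have Ccard i : #|[set p | f p == i]| <= #|C i|.
  have inj : {in [set p | f p == i] &, injective (fun p : V * 'I_q => p.1)}.
    move=> [x j] [y j']; rewrite !inE /= => /eqP fx /eqP fy xy.
    rewrite -{y}xy in fy *; congr pair; apply/eqP/negP => /negP jj'.
    have := fP (x, j) (x, j'); rewrite fx fy eqxx /blowup /= eqxx jj' orbT.
    by move=> /(_ isT).
  rewrite -(card_in_imset inj); apply/subset_leq_card/subsetP => x /imsetP[[y j]].
  by rewrite !inE => fy ->; apply/existsP; exists j.
have card_eq : #|V| * q = \sum_(i < k) #|[set p | f p == i]|.
  rewrite -[q in LHS]card_ord -card_prod -sum1_card (partition_big f predT) //=.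
  by apply: eq_bigr => i _; rewrite sum1dep_card.
rewrite -(leq_pmul2l V0) mulnCA card_eq big_distrr /= mulnC -[k in leqRHS]card_ord -sum_nat_const.
by apply: leq_sum => i _; apply: leq_trans (sparse _ (Cind i)); rewrite leq_mul2l Ccard orbT.
Qed.

Lemma card_ord_lt c a : a <= c -> #|[set x : 'I_c | x < a]| = a.
Proof.
move=> ac; have inj : injective (widen_ord ac).
  by move=> x y /(congr1 val) /= xy; apply: val_inj.
rewrite -[RHS]card_ord -cardsT -(card_imset _ inj); apply: eq_card => x.
rewrite inE; apply/idP/imsetP => [xa|[y _ ->]]; last exact: (ltn_ord y).
by exists (Ordinal xa) => //; apply: val_inj.
Qed.

(** Used for cliques of the exponential graph, whose members get distinct colours: few of them can
    avoid a large set Y of colours. *)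
Lemma card_miss (X : finType) k (g : X -> 'I_k) (A : {set X}) (Y : {set 'I_k}) :
  {in A &, injective g} -> #|[set a in A | g a \notin Y]| + #|Y| <= k.
Proof.
move=> ginj; rewrite -[k in leqRHS]card_ord -(cardsC Y) addnC leq_add2l.
have ginj' : {in [set a in A | g a \notin Y] &, injective g}.
  by move=> a b; rewrite !inE => /andP[aA _] /andP[bA _]; apply: ginj.
rewrite -(card_in_imset ginj'); apply/subset_leq_card/subsetP => y /imsetP[a].
by rewrite !inE => /andP[_ h] ->.
Qed.

(** * Lower bound for the chromatic number of the exponential graph *)

Section ExponentialChromaticNumber.
Variables (V : finType) (e : rel V) (q c k : nat).
Hypotheses (e_sym : symmetric e) (e5 : no_closed_5walk e).
Hypotheses (q0 : 0 < q) (qc : 20 * q <= c) (kc : 100 * k < 101 * c).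
Hypotheses (c100 : 100 <= c) (cbig : 2 * 100 ^ #|V| * #|V| ^ 4 < c).
Variable Psi : {ffun V * 'I_q -> 'I_c} -> 'I_k.
Hypothesis PsiP : forall f g, exponential (@blowup V e q) f g -> Psi f != Psi g.

Let adjeq : rel V := fun x y => e x y || (x == y).

Let lift (f : {ffun V -> 'I_c}) : {ffun V * 'I_q -> 'I_c} := [ffun p => f p.1].

Lemma lift_collide f g : Psi (lift f) = Psi (lift g) ->
  exists x y, adjeq x y /\ f x = g y.
Proof.
move=> fg; have /negP : ~~ exponential (@blowup V e q) (lift f) (lift g).
  by apply/negP => /PsiP; rewrite fg eqxx.
move=> h; have [/existsP[x /existsP[y /andP[xy /eqP eq]]]|noxy] :=
  boolP [exists x, exists y, adjeq x y && (f x == g y)]; first by exists x, y.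
case: h; apply/exponentialP => -[x i] [y j]; rewrite !ffunE /blowup /= => xy.
apply: contra noxy => eq; apply/existsP; exists x; apply/existsP; exists y.
rewrite eq andbT /adjeq; case/orP: xy => [->//|/andP[-> _]]; exact: orbT.
Qed.

(** A triangle followed by a walk back and forth along one edge is a closed 5-walk. *)
Lemma no_triangle x y z : e x y -> e y z -> ~~ e z x.
Proof.
move=> xy yz; apply/negP => zx; have xz : e x z by rewrite e_sym.
by have /negP := e5 xy yz zx xz; apply.
Qed.

Lemma exponential_blowup_not_coloured : False.
Proof.
have [//|||v [R [col [Rcard colinj robust]]]] :=
  @robust_vertex V adjeq c k (Psi \o lift) _ lift_collide 100 _ _ cbig.
- by move=> x y; rewrite /adjeq e_sym eq_sym.
- by lia.
- by lia.
have qc2 : q + q <= c by lia.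
pose P := [set x : 'I_c | x < q + q].
pose near x := (x == v) || [exists y, e v y && e y x].
pose mu (t : 'I_c) : {ffun V * 'I_q -> 'I_c} :=
  [ffun p => if near p.1 then widen_ord qc2 (lshift q p.2)
             else if e v p.1 then widen_ord qc2 (rshift q p.2) else t].
pose cst (b : 'I_c) : {ffun V -> 'I_c} := [ffun=> b].
(* Here [rev_ord b] is the second colour: it maps the lower half of [c] injectively into the upper
   half, so distinct [psi] never collide. *)
pose psi (b : 'I_c) : {ffun V -> 'I_c} :=
  [ffun x => if adjeq v x then b else rev_ord b].
pose S := [set x : 'I_c | x < c./2] :\: P.
have SP b : b \in S -> [/\ b \notin P, b < c./2 & c./2 <= rev_ord b].
  by rewrite !inE => /andP[h1 h2]; split => //=; lia.
have nearW x y : e x y -> near x -> exists2 z, e v z & e z x.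
  move=> exy /orP[/eqP xv|/existsP[z /andP[]]]; last by exists z.
  by exists y; rewrite -?xv // e_sym.
(* Two walks of length 2 from v, closed up by the edge xy, would form a closed 5-walk. *)
have near_edge x y : e x y -> near x -> ~~ near y.
  move=> exy nx; apply/negP => ny.
  have [z vz zx] := nearW _ _ exy nx.
  have [|z' vz' z'y] := nearW y x _ ny; first by rewrite e_sym.
  rewrite e_sym in vz'; rewrite e_sym in z'y.
  by have /negP := e5 vz zx exy z'y; apply.
have muP t p : mu t p = t \/ mu t p \in P.
  rewrite ffunE; case: ifP => _; [right|case: ifP => _; [right|by left]].
    by rewrite inE /= ltn_addr.
  by rewrite inE /= ltn_add2l.
have mu_near t p : near p.1 || e v p.1 -> mu t p \in P.
  rewrite ffunE; case: ifP => _ /=; first by rewrite inE /= ltn_addr.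
  by move=> ->; rewrite inE /= ltn_add2l.
have mu_adj t s : t \notin P -> s \notin P -> t != s ->
    exponential (@blowup V e q) (mu t) (mu s).
  move=> tP sP ts; apply/exponentialP => -[x i] [y j]; rewrite /blowup /= => xy.
  move: tP sP; rewrite !inE -!leqNgt => tP sP.
  rewrite !ffunE /=.
  have iq := ltn_ord i; have jq := ltn_ord j.
  case/orP: xy => [exy|/andP[/eqP <- ij]].
    have nn := near_edge _ _ exy.
    case: (boolP (near x)) => nx; case: (boolP (near y)) => ny.
    - by move: (nn nx); rewrite ny.
    - by case: ifP => _; rewrite -val_eqE /=; lia.
    - by case: ifP => _; rewrite -val_eqE /=; lia.
    - case: (boolP (e v x)) => vx; case: (boolP (e v y)) => vy //.
      + by have /negP[] := no_triangle vx exy; rewrite e_sym.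
      + by rewrite -val_eqE /=; lia.
      + by rewrite -val_eqE /=; lia.
  move: ij; case: ifP => _; [|case: ifP => _ //]; rewrite -!val_eqE /=; lia.
have cst_mu b t : b \notin P -> b != t -> Psi (lift (cst b)) != Psi (mu t).
  move=> bP bt; apply: PsiP; apply/exponentialP => p p' _; have -> : lift (cst b) p = b by rewrite !ffunE.
  case: (muP t p') => [->//|]; by apply: contraTneq => <-.
(* Where [psi b] is b, all neighbours lie within distance 2 of v, where [mu b] has values in P;
   elsewhere [psi b] is neither b nor in P. *)
have psi_mu b : b \in S -> Psi (lift (psi b)) != Psi (mu b).
  case/SP => bP b2 rb; apply: PsiP; apply/exponentialP => -[x i] [y j] xy.
  have -> : lift (psi b) (x, i) = if adjeq v x then b else rev_ord b by rewrite !ffunE.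
  have xy' : adjeq x y.
    by rewrite /adjeq; case/orP: xy => [->//|/andP[-> _]]; rewrite orbT.
  case: ifP => vx; last first.
    case: (muP b (y, j)) => [->|h]; first by rewrite -val_eqE /=; lia.
    by apply: contraTneq h => <-; rewrite inE -leqNgt; lia.
  suff h : near y || e v y by apply: contraNneq bP => ->; exact: mu_near.
  case/orP: vx => [vx|/eqP vx]; last first.
    by move: xy'; rewrite -vx /adjeq /near [y == v]eq_sym => /orP[->|->]; rewrite ?orbT.
  case/orP: xy' => [exy|/eqP <-]; last by rewrite vx orbT.
  by apply/orP; left; apply/orP; right; apply/existsP; exists x; rewrite vx.
have mu_inj : {in S &, injective (Psi \o mu)}.
  move=> t s /SP[tP _ _] /SP[sP _ _] /= eq; apply/eqP; apply: contraPT eq => ts.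
  by apply/eqP/PsiP/mu_adj.
have cst_inj : {in [set: 'I_c] &, injective (Psi \o lift \o cst)}.
  move=> t s _ _ /= eq; apply/eqP; apply: contraPT eq => ts.
  by apply/eqP/PsiP/exponentialP => p p' _; rewrite !ffunE.
have psi_inj : {in S &, injective (Psi \o lift \o psi)}.
  move=> t s /SP[tP t2 rt] /SP[sP s2 rs] /= eq; apply/eqP; apply: contraPT eq => ts.
  apply/eqP/PsiP/exponentialP => p p' _; rewrite !ffunE.
  case: ifP => _; case: ifP => _ //; try by rewrite -val_eqE /=; lia.
  by rewrite (inj_eq rev_ord_inj).
have cst_col b a : a \in R -> Psi (lift (cst b)) = col a -> b = a.
  by move=> aR h; have [w _] := robust a (cst b) aR h; rewrite ffunE.
have psi_col b a : a \in R -> Psi (lift (psi b)) = col a -> b = a.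
  by move=> aR h; have [w vw] := robust a (psi b) aR h; rewrite ffunE vw.
pose M := [set b in [set: 'I_c] | Psi (lift (cst b)) \notin col @: R].
pose D := R :\: (M :|: P).
have colD b : b \in D -> Psi (lift (cst b)) = col b.
  rewrite !inE negb_or negbK /= => /andP[/andP[/imsetP[a aR h] _] bR].
  by rewrite h (cst_col _ _ aR h).
pose B1 := [set t in S | Psi (mu t) \notin col @: D].
pose B2 := [set t in S | Psi (lift (psi t)) \notin col @: R].
have cardR : #|col @: R| = #|R| by exact: card_in_imset.
have DR : D \subset R by exact: subsetDl.
have cardD : #|col @: D| = #|D|.
  by apply: card_in_imset => x y /(subsetP DR) xR /(subsetP DR) yR; apply: colinj.
have hM : #|M| + #|R| <= k by rewrite -cardR; exact: card_miss cst_inj.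
have hB1 : #|B1| + #|D| <= k by rewrite -cardD; exact: card_miss mu_inj.
have hB2 : #|B2| + #|R| <= k by rewrite -cardR; exact: card_miss psi_inj.
have hP : #|P| = q + q by exact: card_ord_lt.
have hD : #|R| <= #|D| + (#|M| + #|P|).
  rewrite -(cardsID (M :|: P) R) addnC leq_add2l.
  apply: leq_trans (leq_card_setU _ _).1; exact/subset_leq_card/subsetIr.
have hS : c./2 <= #|S| + #|P|.
  rewrite -[leqLHS](@card_ord_lt c); last by lia.
  by rewrite -(cardsID P [set x : 'I_c | x < c./2]) addnC leq_add2l subset_leq_card ?subsetIr.
(* Roughly, |R| >= 0.99c and k < 1.01c give |M|, |B2| <= 0.02c; as |P| <= 0.1c, also |D| >= 0.87c,
   |B1| <= 0.14c and |S| >= 0.4c. *)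
have [t tS] : exists2 t, t \in S & t \notin B1 :|: B2.
  apply/subsetPn/negP => /subset_leq_card hle.
  have := leq_trans hle (leq_card_setU B1 B2).1; lia.
rewrite in_setU negb_or [t \in B1]inE [t \in B2]inE tS /= !negbK => /andP[/imsetP[b bD mub] /imsetP[a aR psia]].
have ta := psi_col _ _ aR psia; rewrite -{a}ta in aR psia.
have bP : b \notin P by move: bD; rewrite 2!inE negb_or => /andP[/andP[]].
have bt : b = t.
  apply/eqP; apply: contraTT isT => bt.
  by have /eqP := cst_mu _ _ bP bt; rewrite mub (colD _ bD).
have /eqP := psi_mu _ tS; by rewrite psia mub bt.
Qed.

End ExponentialChromaticNumber.

(** * Choice of parameters and the final bounds *)

Lemma tensor_chromatic_gap : exists c0, forall c, c0 <= c ->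
  exists (T : finType) (eG : rel T) (U : finType) (eH : rel U),
    [/\ simple_graph eG /\ simple_graph eH,
        forall k, colourable eG k -> 101 * c <= 100 * k,
        forall k, colourable eH k -> 101 * c <= 100 * k &
        colourable (tensor_rel eG eH) c].
Proof.
have [V [e [V0 esym e5 sparse]]] := sparse_no_closed_5walk 200.
exists (2 * 100 ^ #|V| * #|V| ^ 4 + 100) => c hc.
(* Rounding up gives 200q > 2c, while 20q <= c still holds for c >= 100. *)
pose q := (c %/ 100).+1.
have cq : c < 100 * q by rewrite mulnC -ltn_divLR.
have qc : 100 * q <= c + 100 by rewrite mulnS addnC leq_add2r mulnC leq_trunc_div.
have eG_col k : colourable (@blowup V e q) k -> 2 * c <= k.
  by move=> /(colourable_blowup_ge V0 sparse); lia.
exists (V * 'I_q)%type, (@blowup V e q).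
exists {ffun V * 'I_q -> 'I_c}, (@exponential _ (@blowup V e q) c).
have blowup_sym : symmetric (@blowup V e q).
  by move=> x y; rewrite /blowup esym [x.1 == _]eq_sym [x.2 == _]eq_sym.
split; [split; split|..].
- exact: blowup_sym.
- move=> x; rewrite /blowup !eqxx /= orbF; apply/negP => xx.
  by have /negP := e5 _ _ _ _ _ xx xx xx xx; apply.
- exact: exponential_sym.
- move=> f; apply/negP => /exponentialP ff.
  (* A loop at f would make f a proper colouring of the blow-up with c < 2c colours. *)
  suff /eG_col : colourable (@blowup V e q) c by lia.
  by exists f => x y; apply: ff.
- by move=> k /eG_col; lia.
- move=> k [Psi PsiP]; rewrite leqNgt; apply/negP => hk.
  by apply: (@exponential_blowup_not_coloured V e q c k esym e5 _ _ hk _ _ Psi PsiP); lia.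
exact: tensor_exponential_colourable.
Qed.

Import Order.TTheory GRing.Theory Num.Theory.
Local Open Scope ring_scope.

Theorem theorem1 :
  exists delta : rat, (1 / 10 ^+ 9 <= delta) /\
  exists c0 : nat, forall c : nat, (c0 <= c)%N ->
    exists (T : finType) (eG : rel T) (U : finType) (eH : rel U),
      simple_graph eG /\ simple_graph eH /\
      forall kG kH kGH : nat,
        chi_of eG kG -> chi_of eH kH -> chi_of (tensor_rel eG eH) kGH ->
        (1 + delta) * c%:R <= kG%:R /\ (1 + delta) * c%:R <= kH%:R /\
        (kGH <= c)%N.
Proof.
exists (1 / 100); split; first by lra.
have [c0 gap] := tensor_chromatic_gap.
exists c0 => c /gap[T [eG [U [eH [[sG sH] hG hH hGH]]]]].
exists T, eG, U, eH; split; [exact: sG | split; [exact: sH|]] => kG kH kGH [/hG cG _] [/hH cH _] [_ hmin].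
have scale k : (101 * c <= 100 * k)%N -> (1 + 1 / 100) * c%:R <= k%:R :> rat.
  by rewrite -(ler_nat rat) !natrM => h; lra.
by split; [exact: scale | split; [exact: scale | exact: hmin]].
Qed.
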